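(* Let $\kappa\in[0,1)$ and $\epsilon>0$. There exist (families of) nonnegative monotone submodular functions with curvature $\kappa$ such that no (possibly randomized) algorithm using value-oracle access and polynomially many (in $n$) queries can achieve an approximation factor of $\frac{n^{1/2-\epsilon}}{1+(n^{1/2-\epsilon}-1)(1-\kappa)}$ for the problem of minimizing $f(X)$ subject to $X\in\{X\subseteq V:|X|\ge k\}$; i.e., no such algorithm guarantees, for all such $f$ on $n$-element $V$ and all $k$, to return $X$ with $|X|\ge k$ and $f(X)\le\frac{n^{1/2-\epsilon}}{1+(n^{1/2-\epsilon}-1)(1-\kappa)}\min_{|Y|\ge k}f(Y)$.
   Context: In the value-oracle model the algorithm accesses $f$ only by queries returning $f(S)$. Curvature: $\kappa_f = 1-\min_{j\in V}\frac{f(j\mid V\setminus\{j\})}{f(\{j\})}$ with $f(j\mid S)=f(S\cup\{j\})-f(S)$, $f(\emptyset)=0$.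
   Formalization: The claim for the stated factor is proved for κ in (0,1); at κ=0 the factor is 1 and f is modular, so n singleton queries achieve it and the claim is false there; for κ=0 only factors strictly below the stated one are excluded. *)

(* Defs.v *)
From mathcomp Require Import all_boot all_order all_algebra.
From mathcomp Require Import all_classical all_reals all_analysis.
Import Order.TTheory GRing.Theory Num.Theory.

Set Implicit Arguments.
Unset Strict Implicit.
Unset Printing Implicit Defensive.

Local Open Scope classical_set_scope.
Local Open Scope ring_scope.

Section SetFunctions.
Context {R : realType} {V : finType}.
Implicit Types (f : {set V} -> R) (S X Y : {set V}).

Definition marginal f (j : V) S : R := f (j |: S)%SET - f S.

Definition monotone_setfun f : Prop := forall X Y, X \subset Y -> f X <= f Y.

Definition submodular f : Prop :=
  forall X Y, f (X :|: Y)%SET + f (X :&: Y)%SET <= f X + f Y.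

(* The default value 1 of the minimum only matters when V is empty: if f is
   submodular and f set0 = 0, every ratio is at most 1.  A null singleton
   value f [set j] = 0 makes the ratio 0, hence the curvature at least 1. *)
Definition curvature f : R :=
  1 - \big[Num.min/1]_(j : V) (marginal f j [set~ j]%SET / f [set j]%SET).

Definition monotone_submodular_with_curvature (kappa : R) f : Prop :=
  [/\ f finset.set0 = 0, (forall X, 0 <= f X), monotone_setfun f, submodular f
    & curvature f = kappa].

(* min_(|Y| >= k) f Y; only meaningful for k <= #|V|, in which case the default
   value is attained by a feasible set. *)
Definition card_opt f (k : nat) : R :=
  \big[Num.min/f [set: V]%SET]_(Y : {set V} | (k <= #|Y|)%N) f Y.

End SetFunctions.

(* A deterministic adaptive value-oracle algorithm, as a decision tree: the
   values returned by the oracle are the only access to f.  Computation between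
   queries is unrestricted. *)
Inductive query_algorithm (R : Type) (V : finType) : Type :=
| Return of {set V}
| Query of {set V} & (R -> query_algorithm R V).

Fixpoint output (R : Type) (V : finType) (f : {set V} -> R)
    (A : query_algorithm R V) : {set V} :=
  match A with
  | Return X => X
  | Query X next => output f (next (f X))
  end.

Fixpoint query_count (R : Type) (V : finType) (f : {set V} -> R)
    (A : query_algorithm R V) : nat :=
  match A with
  | Return _ => 0%N
  | Query X next => (query_count f (next (f X))).+1
  end.

(* A randomized algorithm is a probability distribution over deterministic ones,
   on an arbitrary probability space, such that the output on each oracle is a
   random variable.  Deterministic algorithms are the constant case. *)
Record randomized_algorithm (R : realType) (V : finType) := RandomizedAlgorithm {
  coin_display : measure_display;
  coins : measurableType coin_display;
  coin_law : probability coins R;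
  procedure : coins -> query_algorithm R V;
  measurable_output : forall (f : {set V} -> R) (X : {set V}),
    measurable [set w : coins | output f (procedure w) = X] }.

(* One set of oracles on 'I_n for each n. *)
Definition oracle_class (R : realType) := forall n, set ({set 'I_n} -> R).

(* The parameters n and k are known to the algorithm. *)
Definition algorithm_family (R : realType) :=
  forall n, nat -> randomized_algorithm R 'I_n.

Definition polynomially_many_queries (R : realType) (F : oracle_class R)
    (A : algorithm_family R) : Prop :=
  exists p : {poly nat}, forall n k (f : {set 'I_n} -> R) (w : coins (A n k)),
    (k <= n)%N -> F n f -> (query_count f (procedure w) <= p.[n])%N.

Definition approximates (R : realType) (k : nat) (V : finType)
    (f : {set V} -> R) (rho : R) (X : {set V}) : Prop :=
  (k <= #|X|)%N /\ f X <= rho * card_opt f k.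

Definition achieves_factor (R : realType) (F : oracle_class R)
    (A : algorithm_family R) (rho : nat -> R) (delta : R) : Prop :=
  forall n k (f : {set 'I_n} -> R), (k <= n)%N -> F n f ->
    (delta%:E <= coin_law (A n k)
       [set w | approximates k f (rho n) (output f (procedure w))])%E.

(* Hardness holds for every constant success probability delta > 0; delta = 1
   is the case of an algorithm that succeeds almost surely. *)
Definition no_polynomial_query_algorithm (R : realType) (F : oracle_class R)
    (rho : nat -> R) : Prop :=
  forall delta : R, 0 < delta ->
    ~ exists A : algorithm_family R,
        polynomially_many_queries F A /\ achieves_factor F A rho delta.

Definition curvature_factor (R : realType) (kappa eps : R) (n : nat) : R :=
  let m := n%:R `^ (2^-1 - eps) in m / (1 + (m - 1) * (1 - kappa)).

(* Main.v *)
(* Plant a random set [S] of size [a] and compare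
     f_S X = kappa * min (|X \ S| + min |X /\ S| b) a + (1 - kappa) * |X|
   with the unplanted f_0.  Both have curvature [kappa].  For k = a the optimum
   of f_S is at most kappa * b + (1 - kappa) * a, attained on [S], whereas every
   feasible set on which f_S agrees with f_0 costs at least [a]; with
   a / b > n ^ (1 / 2 - eps) the ratio exceeds the curvature factor (equals it when kappa = 0).  A query
   [Q] separates f_S from f_0 only if [S] meets a fixed set of size at most [a]
   in at least [b] points, which happens for at most a fraction (a ^ 2 / n) ^ b
   of the sets [S].  The constant [b] is chosen after the polynomial bounding the
   number of queries, so that most [S] survive every query made on f_0, and then
   the algorithm outputs on f_S what it outputs on f_0.  The averaging is over
   [S] and the coins simultaneously. *)
Require Import Defs.
From mathcomp Require Import all_boot all_order all_algebra.
From mathcomp Require Import all_classical all_reals all_analysis.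
From mathcomp Require Import measurable_realfun.
From mathcomp Require Import zify ring lra.

Set Implicit Arguments.
Unset Strict Implicit.
Unset Printing Implicit Defensive.

Import Order.TTheory GRing.Theory Num.Theory.

Local Open Scope classical_set_scope.
Local Open Scope ring_scope.

(** * Counting the sets that meet a fixed set in many points *)

Lemma exists_subset_card (T : finType) (A : {set T}) (m : nat) :
  (m <= #|A|)%N -> exists2 B : {set T}, B \subset A & #|B| = m.
Proof.
move=> mA; have : (0 < #|[set B : {set T} | B \subset A & #|B| == m]%SET|)%N.
  by rewrite cards_draws bin_gt0.
by case/card_gt0P => B; rewrite inE => /andP[BA /eqP Bm]; exists B.
Qed.

(** For [S] in this family, [S :\: B] determines [S] and is an [(a - #|B|)]-subset of the complement
    of [B]. *)
Lemma card_supersets (T : finType) (B : {set T}) (a : nat) :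
  (#|[set S : {set T} | (B \subset S) && (#|S| == a)]%SET|
     <= 'C(#|T| - #|B|, a - #|B|))%N.
Proof.
have -> : (#|T| - #|B| = #|~: B|%SET)%N by rewrite -(cardsC B) addKn.
rewrite -cards_draws -(@card_in_imset _ _ (fun S => S :\: B)%SET); last first.
  move=> S S'; rewrite !inE => /andP[BS _] /andP[BS' _] eqD.
  by rewrite -(finset.setID S B) -(finset.setID S' B) (finset.setIidPr BS)
    (finset.setIidPr BS') eqD.
apply/subset_leq_card/fintype.subsetP => _ /imsetP[S + ->].
rewrite !inE => /andP[BS /eqP <-].
by rewrite finset.setDE finset.subsetIr /= -finset.setDE cardsDS.
Qed.

(** ['C(n - b, a - b) / 'C(n, a)] is the product of [(a - i) / (n - i)] over [i < b], each factor
    being at most [a / n]. *)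
Lemma bin_sub_expn (n a b : nat) : (b <= a <= n)%N ->
  ('C(n - b, a - b) * n ^ b <= 'C(n, a) * a ^ b)%N.
Proof.
elim: b => [|b IHb] /andP[ba an]; first by rewrite !subn0 !expn0.
have {}IHb : ('C(n - b, a - b) * n ^ b <= 'C(n, a) * a ^ b)%N.
  by apply: IHb; rewrite (ltnW ba).
have step : ((n - b) * 'C(n - b.+1, a - b.+1) = (a - b) * 'C(n - b, a - b))%N.
  have -> : (n - b = (n - b.+1).+1)%N by lia.
  have -> : (a - b = (a - b.+1).+1)%N by lia.
  exact: mul_bin_diag.
rewrite -(@leq_pmul2l (n - b)); last by lia.
rewrite mulnA step !expnSr.
apply: (@leq_trans ((a - b) * n * ('C(n - b, a - b) * n ^ b))); first by lia.
apply: (@leq_trans ((n - b) * a * ('C(n, a) * a ^ b))); last by lia.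
by apply: leq_mul => //; rewrite !mulnBl leq_sub // ?leq_mul2l; nia.
Qed.

Lemma bin_le_expn (n m : nat) : ('C(n, m) <= n ^ m)%N.
Proof.
apply: (@leq_trans (n ^_ m)); first by rewrite -bin_ffact leq_pmulr ?fact_gt0.
by rewrite ffact_prod -[m in X in (_ <= X)%N]card_ord -prod_nat_const;
  apply: leq_prod => i _; exact: leq_subr.
Qed.

Lemma card_bigcup_le (I T : finType) (P : pred I) (F : I -> {set T}) :
  (#|\bigcup_(i | P i) F i|%SET <= \sum_(i | P i) #|F i|)%N.
Proof.
elim/big_rec2: _ => [|i m A _ IH]; first by rewrite cards0.
by apply: leq_trans (leq_card_setU _ _) _; rewrite leq_add2l.
Qed.

(** Union bound over the [b]-subsets of [Q], at most [a ^ b] in number, one of which [S] must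
    contain. *)
Lemma card_large_meet (T : finType) (Q : {set T}) (a b : nat) :
  (#|Q| <= a)%N -> (b <= a <= #|T|)%N ->
  (#|[set S : {set T} | (#|S| == a) && (b <= #|S :&: Q|)%N]%SET| * #|T| ^ b
     <= a ^ b * a ^ b * 'C(#|T|, a))%N.
Proof.
move=> Qa bT; set D := [set B : {set T} | B \subset Q & #|B| == b]%SET.
have cover : ([set S : {set T} | (#|S| == a) && (b <= #|S :&: Q|)%N] \subset
    \bigcup_(B in D) [set S : {set T} | (B \subset S) && (#|S| == a)])%SET.
  apply/fintype.subsetP => S; rewrite inE => /andP[Sa /exists_subset_card[B]].
  rewrite finset.subsetI => /andP[BS BQ] Bb; apply/finset.bigcupP; exists B.
    by rewrite inE BQ Bb eqxx.
  by rewrite inE BS.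
have card_bad : (#|[set S : {set T} | (#|S| == a) && (b <= #|S :&: Q|)%N]%SET|
    <= 'C(#|Q|, b) * 'C(#|T| - b, a - b))%N.
  apply: leq_trans (subset_leq_card cover) _.
apply: leq_trans (card_bigcup_le _ _) _.
  rewrite -cards_draws -sum_nat_const.
  apply: leq_sum => B; rewrite inE => /andP[_ /eqP <-]; exact: card_supersets.
apply: (@leq_trans ('C(#|Q|, b) * 'C(#|T| - b, a - b) * #|T| ^ b)).
  by rewrite leq_mul2r card_bad orbT.
rewrite -!mulnA [X in (_ <= _ * X)%N]mulnC leq_mul ?bin_sub_expn //.
rewrite (leq_trans (bin_le_expn _ _)) //.
by case: b {bT D cover card_bad} => // b; rewrite leq_exp2r.
Qed.

(** * Runs of a query algorithm *)

Section Transcript.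
Context {R : Type} {V : finType}.

(** The returned set is listed after the queries, so that agreement on a transcript also covers the
    value at the output. *)
Fixpoint transcript (f : {set V} -> R) (A : query_algorithm R V) :
    seq {set V} :=
  match A with
  | Return X => [:: X]
  | Query X next => X :: transcript f (next (f X))
  end.

Lemma size_transcript (f : {set V} -> R) (A : query_algorithm R V) :
  size (transcript f A) = (query_count f A).+1.
Proof. by elim: A => //= X next IH; rewrite IH. Qed.

Lemma output_in_transcript (f : {set V} -> R) (A : query_algorithm R V) :
  output f A \in transcript f A.
Proof. by elim: A => [X|X next IH] /=; rewrite inE ?eqxx ?IH ?orbT. Qed.

Lemma output_eq_on_transcript (f g : {set V} -> R) (A : query_algorithm R V) :
  (forall Q, Q \in transcript f A -> g Q = f Q) -> output g A = output f A.
Proof.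
elim: A => //= X next IH agree; rewrite agree ?mem_head //.
by apply: IH => Q Qnext; apply: agree; rewrite inE Qnext orbT.
Qed.

End Transcript.

(** * The planted rank function *)

Section Planted.
Context {V : finType}.
Implicit Types (S X Y Q : {set V}) (a b : nat).

(** Rank function of a matroid: all points off [S] are free, at most [b] points of [S] are
    independent, and the rank is truncated to [a]. *)
Definition planted a b S X : nat := minn (#|X :\: S| + minn #|X :&: S| b) a.

Lemma planted0 a b X : planted a b finset.set0 X = minn #|X| a.
Proof. by rewrite /planted finset.setD0 finset.setI0 cards0 min0n addn0. Qed.

Lemma planted_self a b S : (planted a b S S <= b)%N.
Proof. by rewrite /planted finset.setDv cards0 add0n; lia. Qed.

Lemma planted_mono a b S X Y : X \subset Y ->
  (planted a b S X <= planted a b S Y)%N.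
Proof.
move=> XY; rewrite /planted.
have := subset_leq_card (finset.setSD S XY); have := subset_leq_card (finset.setSI S XY).
by lia.
Qed.

Lemma planted_submod a b S X Y :
  (planted a b S (X :|: Y)%SET + planted a b S (X :&: Y)%SET
     <= planted a b S X + planted a b S Y)%N.
Proof.
(* The two cardinalities are modular in [X]; monotonicity is what carries submodularity through the
   truncations [minn]. *)
have mono (Z W : {set V}) : Z \subset W ->
    (#|Z :&: S|%SET <= #|W :&: S|%SET)%N /\ (#|Z :\: S|%SET <= #|W :\: S|%SET)%N.
  by move=> ZW; rewrite !subset_leq_card ?finset.setSD ?finset.setSI.
have [] := mono _ _ (finset.subsetIl X Y); have [] := mono _ _ (finset.subsetIr X Y).
have [] := mono _ _ (finset.subsetUl X Y); have [] := mono _ _ (finset.subsetUr X Y).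
have := cardsUI (X :&: S) (Y :&: S); have := cardsUI (X :\: S) (Y :\: S).
rewrite -finset.setDUl -finset.setDIl -finset.setIUl -finset.setIIl /planted.
by lia.
Qed.

(* A query larger than [a] is trimmed to size [a]: the elements removed from it
   lower the planted value by as much as they can meet the planted set. *)
Lemma planted_neq a b Q : exists2 Q' : {set V}, (#|Q'| <= a)%N &
  forall S, #|S| = a -> planted a b S Q != planted a b finset.set0 Q ->
    (b <= #|S :&: Q'|)%N.
Proof.
have [Q' sub cardQ'] := exists_subset_card (geq_minl #|Q| a).
exists Q'; first by rewrite cardQ' geq_minr.
move=> S Sa; rewrite planted0 /planted => neq.
have := cardsID S Q; have := cardsDS sub.
have : (#|Q :&: S| <= #|S :&: Q'| + #|Q :\: Q'|)%N.
  apply: leq_trans (leq_card_setU _ _); apply/subset_leq_card/fintype.subsetP => x.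
  by rewrite !inE => /andP[-> ->]; case: (x \in Q').
have := subset_leq_card sub.
by move: neq cardQ'; lia.
Qed.

End Planted.

(** [X] already has [a] points outside [S]. Hence the planted part is constant near the full set,
    where curvature is measured. *)
Lemma planted_sat (V : finType) (a b : nat) (S X : {set V}) :
  (#|S| <= a)%N -> (2 * a <= #|X|)%N -> planted a b S X = a.
Proof.
move=> Sa aX; have := cardsID S X.
have := subset_leq_card (finset.subsetIr X S); rewrite /planted; lia.
Qed.

Lemma planted_small (V : finType) (a b : nat) (S X : {set V}) :
  (#|X| <= a)%N -> (#|X| <= b)%N -> planted a b S X = #|X|.
Proof. by move=> Xa Xb; have := cardsID S X; rewrite /planted; lia. Qed.

(** * Curvature, values and optimum of the hard functions *)

Section HardFunction.
Context {R : realType} {V : finType}.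
Variables (kappa : R) (a b : nat).
Implicit Types S X : {set V}.

Definition hard_function S X : R :=
  kappa * (planted a b S X)%:R + (1 - kappa) * #|X|%:R.

Hypotheses (kappa_ge0 : 0 <= kappa) (kappa_lt1 : kappa < 1).

Lemma hard_function_ge0 S X : 0 <= hard_function S X.
Proof. by rewrite addr_ge0 // mulr_ge0 // subr_ge0 ltW. Qed.

(** Since [2 * a < #|V|], the planted part is saturated on [[set~ j]], so the last marginal is
    [1 - kappa]; singletons have value 1. Every curvature ratio is thus [1 - kappa]. *)
Lemma hard_function_class S :
  (0 < b)%N -> (0 < a)%N -> (2 * a < #|V|)%N -> (#|S| <= a)%N ->
  monotone_submodular_with_curvature kappa (hard_function S).
Proof.
move=> b0 a0 aV Sa; have kappa1 : 0 <= 1 - kappa by rewrite subr_ge0 ltW.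
split; [|exact: hard_function_ge0| | |].
- by rewrite /hard_function planted_small cards0 // !mulr0 addr0.
- move=> X Y XY; rewrite lerD // ler_wpM2l // ler_nat.
    exact: planted_mono.
  exact: subset_leq_card.
- move=> X Y; rewrite /hard_function.
  have regroup (p q r s : R) : kappa * p + (1 - kappa) * r +
      (kappa * q + (1 - kappa) * s) = kappa * (p + q) + (1 - kappa) * (r + s).
    by ring.
  rewrite !regroup -!natrD cardsUI lerD2r ler_wpM2l // ler_nat.
  exact: planted_submod.
have ratio j : marginal (hard_function S) j [set~ j]%SET /
    hard_function S [set j]%SET = 1 - kappa.
  rewrite /marginal /hard_function finset.setUCr
    (@planted_small _ _ _ _ [set j]%SET) cards1 //.
  rewrite !planted_sat ?cardsC1 ?cardsT //; try lia.
  rewrite -subn1 natrB; last by lia.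
  by rewrite !mulr1 [kappa + _]addrC subrK divr1; ring.
rewrite /curvature (eq_bigr (fun=> 1 - kappa)) //
  (_ : \big[_/_]_(_ : V) _ = 1 - kappa) ?subKr //.
(* A point of [V] brings the minimum below its default value 1. *)
have /card_gt0P[j _] : (0 < #|V|)%N by lia.
apply/le_anti/andP; split; first exact: (@bigmin_le_cond _ _ _ _ j).
by apply: le_bigmin; rewrite // gerBl.
Qed.

Lemma hard_function_ge S X : planted a b S X = planted a b finset.set0 X ->
  (a <= #|X|)%N -> a%:R <= hard_function S X.
Proof.
rewrite planted0 /hard_function => -> aX; rewrite (minn_idPr aX).
rewrite -lerBlDl (_ : a%:R - kappa * a%:R = (1 - kappa) * a%:R); last by ring.
by rewrite ler_wpM2l ?subr_ge0 ?(ltW kappa_lt1) // ler_nat.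
Qed.

Lemma card_opt_hard_function S : #|S| = a ->
  0 <= card_opt (hard_function S) a <= kappa * b%:R + (1 - kappa) * a%:R.
Proof.
move=> Sa; apply/andP; split.
  by apply: le_bigmin => *; exact: hard_function_ge0.
apply: (@le_trans _ _ (hard_function S S)).
  by apply: (@bigmin_le_cond _ _ _ _ S); rewrite Sa.
by rewrite /hard_function Sa lerD2r ler_wpM2l // ler_nat planted_self.
Qed.

End HardFunction.

(** The denominator is [kappa + m * (1 - kappa)]; clearing it reduces the bound for the largest [v]
    to [kappa * (m * b) <= kappa * a]. This is strict when [0 < kappa]; in the other case strictness
    comes from [rho]. *)
Lemma factor_mul_opt_lt (R : realType) (kappa m a b v rho : R) :
  0 <= kappa -> kappa < 1 -> 0 < m -> 0 <= b -> m * b < a ->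
  0 <= v <= kappa * b + (1 - kappa) * a ->
  rho <= m / (1 + (m - 1) * (1 - kappa)) ->
  0 < kappa \/ rho < m / (1 + (m - 1) * (1 - kappa)) ->
  rho * v < a.
Proof.
move=> k0 k1 m0 b0 mba /andP[v0 vle] rhole strict.
have D0 : 0 < 1 + (m - 1) * (1 - kappa) by nra.
have apos : 0 < a by nra.
set c := m / _ in rhole strict.
have c0 : 0 < c by rewrite divr_gt0.
have cD : c * (1 + (m - 1) * (1 - kappa)) = m by rewrite /c divfK // gt_eqF.
have cU : c * (kappa * b + (1 - kappa) * a) <= a.
  by rewrite -(ler_pM2r D0) mulrAC cD; nra.
case: strict => [kappa0|rholt].
  apply: (@le_lt_trans _ _ (c * (kappa * b + (1 - kappa) * a))).
    by apply: (@le_trans _ _ (c * v)); rewrite ?ler_wpM2r ?ler_wpM2l // ltW.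
  by rewrite -(ltr_pM2r D0) mulrAC cD; nra.
have [->|vn0] := eqVneq v 0; first by rewrite mulr0.
apply: (@lt_le_trans _ _ (c * v)); first by rewrite ltr_pM2r // lt_def vn0.
by apply: le_trans cU; rewrite ler_wpM2l // ltW.
Qed.

(** * Averaging over the coins *)

(** The sum is the expected number of events [A i] with [i \in D] that occur. *)
Lemma sum_probability_le (d : measure_display) (T : measurableType d)
    (R : realType) (P : probability T R) (I : finType) (D : {set I})
    (A : I -> set T) (M : nat) :
  (forall i, measurable (A i)) ->
  (forall w, #|[set i in D | w \in A i]%SET| <= M)%N ->
  (\sum_(i in D) P (A i) <= M%:R%:E)%E.
Proof.
move=> mA cover.
have mI i : measurable_fun [set: T] (fun w => (\1_(A i) w : R)%:E).
  by apply/measurable_EFinP; exact: measurable_indic.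
have -> : (\sum_(i in D) P (A i) =
    \int[P]_w \sum_(i <- enum D) (\1_(A i) w : R)%:E)%E.
  rewrite ge0_integral_sum // -?big_enum //=.
  by apply: eq_bigr => i _; rewrite integral_indic // setIT.
have -> : (M%:R%:E = \int[P]_w (M%:R%:E : \bar R))%E.
  rewrite integral_cst; last exact: measurableT.
  rewrite -[LHS]mule1; congr (_ * _)%E.
  by apply: esym; exact: probability_setT.
apply: ge0_le_integral => //.
- by move=> w _; apply: sume_ge0 => i _.
- exact: emeasurable_sum.
- move=> w _; rewrite sumEFin lee_fin big_enum /=.
  apply: le_trans (_ : #|[set i in D | w \in A i]%SET|%:R <= _); last first.
    by rewrite ler_nat.
  rewrite -sum1_card natr_sum [leRHS]big_mkcond [leLHS]big_mkcond /=.
  by apply: ler_sum => i _; rewrite inE indicE; case: ifP => //=; case: (w \in A i).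
Qed.

Lemma measurable_output_pred (R : realType) (V : finType)
    (A : randomized_algorithm R V) (f : {set V} -> R) (Q : {set V} -> Prop) :
  measurable [set w : coins A | Q (output f (procedure w))].
Proof.
rewrite (_ : [set w | _] =
  \bigcup_(X in [set X | Q X]) [set w : coins A | output f (procedure w) = X]).
  by apply: fin_bigcup_measurable => [|X _];
    [exact: finite_finset|exact: measurable_output].
by apply/seteqP; split=> [w Qw|w [X QX /= ->]] //=; exists (output f (procedure w)).
Qed.

(** * Choice of the parameters *)

(* With [n = s ^ (2 t)], the bounds [n ^ (1 / 2 - 1 / (2 t)) = s ^ (t - 1)] and
   [a <= 2 b s ^ (t - 1)] give [(a ^ 2 / n) ^ b <= (4 b ^ 2) ^ b / s ^ (2 b)],
   and [b] is chosen so that [s ^ (2 b)] beats the polynomial [p.[n]]. *)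
Lemma hard_parameters (R : realType) (eps delta : R) (p : {poly nat}) :
  0 < eps -> 0 < delta ->
  exists n a b : nat, [/\ (0 < b <= a)%N, (2 * a < n)%N,
    n%:R `^ (2^-1 - eps) * b%:R < a%:R :> R
  & (p.[n].+1 * (a ^ b * a ^ b))%:R < delta * (n ^ b)%:R].
Proof.
move=> eps0 delta0.
pose t := (Num.truncn eps^-1).+1.
have t_inv : (t%:R)^-1 <= eps.
  by rewrite -[leRHS]invrK lef_pV2 ?posrE ?invr_gt0 // ltW // truncnS_gt.
(* Chosen so that [n ^ size p * s <= s ^ (2 * b)]. *)
pose b := (t * size p).+1.
pose C := (\sum_(i < size p) (p`_i)%R).+1.
pose K := (C * (4 * b ^ 2) ^ b)%N.
(* The first summand gives [K < delta * s], the second gives [4 * b < s], whence [2 * a < n]. *)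
pose s := ((Num.truncn (K%:R / delta)).+1 + 4 * b)%N.
have s0 : (0 < s)%N by [].
have sK : K%:R < delta * s%:R.
  rewrite mulrC -ltr_pdivrMr //; apply: lt_le_trans (truncnS_gt _) _.
  by rewrite ler_nat leq_addr.
pose n := (s ^ (2 * t))%N; pose a := (b * s ^ t.-1).+1.
have st0 : (0 < s ^ t.-1)%N by rewrite expn_gt0 s0.
have nE : n = (s ^ t.-1 * s ^ t.-1 * s * s)%N.
  by rewrite /n (_ : 2 * t = t.-1 + t.-1 + 1 + 1)%N ?expnD //; lia.
have a_le : (a <= 2 * b * s ^ t.-1)%N by rewrite /a; nia.
have s_gt : (4 * b < s)%N by rewrite /s; lia.
exists n, a, b; split.
- by rewrite /a /=; nia.
- rewrite nE; apply: (@leq_ltn_trans (s ^ t.-1 * (4 * b))%N); first by lia.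
  apply: (@leq_trans (s ^ t.-1 * s)%N); first by rewrite ltn_pmul2l.
  by rewrite leq_mul2r -[leqLHS]muln1 -mulnA leq_mul2l muln_gt0 st0 s0 !orbT.
- apply: (@le_lt_trans _ _ ((s ^ t.-1)%:R * b%:R)); last first.
    by rewrite -natrM ltr_nat ltnS mulnC.
  rewrite ler_wpM2r //.
  have n1 : 1 <= n%:R :> R by rewrite ler1n expn_gt0 s0.
  apply: (@le_trans _ _ (n%:R `^ (2^-1 - (2 * t%:R)^-1))).
    apply: ler_powR => //; rewrite lerD2l lerN2; apply: le_trans t_inv.
    rewrite lef_pV2 ?posrE ?mulr_gt0 ?ltr0n //.
    by rewrite ler_peMl // ler1n.
  rewrite /n !natrX -[_ ^+ (2 * t)]powR_mulrn // -powRrM.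
  have -> : (2 * t)%:R * (2^-1 - (2 * t%:R)^-1) = (t.-1)%:R :> R.
    rewrite natrM mulrBr mulrAC divff // mul1r divff ?mulf_neq0 ?pnatr_eq0 //.
    by rewrite -[t in LHS]/(t.-1.+1) -addn1 natrD addrK.
  by rewrite powR_mulrn.
have pn : (p.[n].+1 <= C * n ^ size p)%N.
  have n0 : (0 < n)%N by rewrite expn_gt0 s0.
  rewrite /C mulSn addnC -addn1 leq_add ?expn_gt0 ?n0 //.
  rewrite horner_coef big_distrl /=; apply: leq_sum => i _.
  by rewrite leq_mul2l natrXE leq_pexp2l ?orbT // ltnW.
have ab : (a ^ b * a ^ b * s ^ (2 * b) <= (4 * b ^ 2) ^ b * n ^ b)%N.
  rewrite expnM -!expnMn leq_exp2r //.
  rewrite nE; have := leq_mul a_le a_le; set x := (s ^ t.-1)%N; nia.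
have main : (p.[n].+1 * (a ^ b * a ^ b) * s <= K * n ^ b)%N.
  have n0 : (0 < n ^ size p)%N by rewrite !expn_gt0 s0.
  have n_s : (n ^ size p * s <= s ^ (2 * b))%N.
    by rewrite /n -expnM -expnSr leq_pexp2l // /b; lia.
  rewrite -(leq_pmul2l n0).
  apply: (@leq_trans (p.[n].+1 * (a ^ b * a ^ b * s ^ (2 * b)))%N).
    rewrite (_ : n ^ size p * (p.[n].+1 * (a ^ b * a ^ b) * s) =
      p.[n].+1 * (a ^ b * a ^ b * (n ^ size p * s)))%N; last by lia.
    by rewrite !leq_mul2l n_s !orbT.
  apply: leq_trans (leq_mul pn ab) _; rewrite /K; lia.
have sR : 0 < s%:R :> R by rewrite ltr0n.
rewrite -(ltr_pM2r sR) -natrM; apply: (@le_lt_trans _ _ (K * n ^ b)%:R).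
  by rewrite ler_nat.
by rewrite natrM mulrAC ltr_pM2r // ltr0n !expn_gt0 s0.
Qed.

(** * Defeating a given algorithm *)

Lemma curvature_class_hardness (R : realType) (kappa eps : R) (rho : nat -> R) :
  0 <= kappa -> kappa < 1 -> 0 < eps ->
  (forall n, rho n <= curvature_factor kappa eps n) ->
  (0 < kappa \/ forall n, rho n < curvature_factor kappa eps n) ->
  no_polynomial_query_algorithm
    (fun n => [set f | monotone_submodular_with_curvature kappa f]
      : set ({set 'I_n} -> R)) rho.
Proof.
move=> kappa0 kappa1 eps0 rho_le strict delta delta0 [A [[p Ap] Adelta]].
have [n [a [b [/andP[b0 ba] an ab count]]]] := hard_parameters p eps0 delta0.
have class (S : {set 'I_n}) : (#|S| <= a)%N ->
    monotone_submodular_with_curvature kappa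
      (hard_function kappa a b S : {set 'I_n} -> R).
  by move=> Sa; apply: hard_function_class; rewrite // ?card_ord //; lia.
have ale : (a <= n)%N by lia.
pose f S : {set 'I_n} -> R := hard_function kappa a b S.
pose D := [set S : {set 'I_n} | #|S| == a]%SET.
have cardD : #|D| = 'C(n, a) by rewrite card_draws card_ord.
pose good S := [set w : coins (A n a) |
  approximates a (f S) (rho n) (output (f S) (procedure w))].
have sum_ge : ((delta * #|D|%:R)%:E <= \sum_(S in D) coin_law (A n a) (good S))%E.
  rewrite mulr_natr -sumr_const -sumEFin; apply: lee_sum => S.
  by rewrite inE => /eqP Sa; apply: Adelta => //; apply: class; rewrite Sa.
(* For fixed coins, [M] bounds the number of [S] on which the algorithm succeeds: the length of a
   transcript times the number of [S] that one set can separate. *)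
pose M := (p.[n].+1 * (a ^ b * a ^ b * 'C(n, a) %/ n ^ b))%N.
have n0 : (0 < n ^ b)%N by rewrite expn_gt0; lia.
have sum_le : (\sum_(S in D) coin_law (A n a) (good S) <= M%:R%:E)%E.
  apply: sum_probability_le => [S|w]; first exact: measurable_output_pred.
  (* This run on the unplanted function does not depend on [S]. *)
  set ts := transcript (f finset.set0) (procedure w).
  have size_ts : (size ts <= p.[n].+1)%N.
    by rewrite size_transcript ltnS; apply: Ap => //; apply: class; rewrite cards0.
  pose fooled (Q : {set 'I_n}) :=
    [set S in D | planted a b S Q != planted a b finset.set0 Q]%SET.
  have card_fooled Q : (#|fooled Q| <= a ^ b * a ^ b * 'C(n, a) %/ n ^ b)%N.
    have [Q' Q'a fooledP] := planted_neq a b Q.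
    rewrite leq_divRL //.
    have := @card_large_meet _ Q' a b Q'a; rewrite card_ord ba ale => /(_ isT).
    apply: leq_trans.
    rewrite leq_mul2r; apply/orP; right; apply/subset_leq_card/fintype.subsetP => S.
    by rewrite !inE => /andP[/[dup] /eqP Sa -> neq]; exact: fooledP.
  (* If no set in [ts] separates [S], the output on [f S] is the unplanted one, and it is either too
     small or costs at least [a], more than the factor allows. *)
  have cover : [set S in D | w \in good S]%SET \subset
      (\bigcup_(i < size ts) fooled (nth finset.set0 ts i))%SET.
    apply/fintype.subsetP => S; rewrite inE => /andP[SD]; rewrite in_setE => -[].
    have Sa : #|S| = a by move: SD; rewrite inE => /eqP.
    case: (boolP (all (fun Q => planted a b S Q == planted a b finset.set0 Q) ts)).
      move=> /allP agree.
      have -> : output (f S) (procedure w) = output (f finset.set0) (procedure w).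
        apply: output_eq_on_transcript => Q /agree /eqP.
        by rewrite /f /hard_function => ->.
      move=> aX; rewrite leNgt => /negP[].
      have := hard_function_ge kappa1 (eqP (agree _ (output_in_transcript _ _))) aX.
      apply: lt_le_trans.
      apply: (factor_mul_opt_lt kappa0 kappa1 _ (ler0n _ b) ab) => //.
      - by rewrite powR_gt0 // ltr0n; lia.
      - exact: card_opt_hard_function.
      - by case: strict; [left|right].
    case/allPn => Q Qts neq _ _; have Qi := Qts; rewrite -index_mem in Qi.
    apply/finset.bigcupP; exists (Ordinal Qi) => //=.
    by rewrite nth_index // inE SD neq.
  apply: leq_trans (subset_leq_card cover) _.
  apply: leq_trans (card_bigcup_le _ _) _.
  apply: (@leq_trans (\sum_(i < size ts) (a ^ b * a ^ b * 'C(n, a) %/ n ^ b))).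
    by apply: leq_sum => i _; exact: card_fooled.
  by rewrite sum_nat_const card_ord leq_mul2r size_ts orbT.
(* Now [delta * 'C(n, a) <= M]; cancelling the binomial contradicts [count]. *)
have := le_trans sum_ge sum_le; rewrite lee_fin leNgt => /negP[].
have C0 : 0 < ('C(n, a))%:R :> R by rewrite ltr0n bin_gt0.
rewrite cardD -(@ltr_pM2r _ (n ^ b)%:R) ?ltr0n // mulrAC.
apply: (@le_lt_trans _ _ ((p.[n].+1 * (a ^ b * a ^ b))%:R * ('C(n, a))%:R)).
  rewrite -!natrM ler_nat /M -[leqLHS]mulnA -[leqRHS]mulnA.
  by rewrite leq_mul // leq_trunc_div.
by rewrite ltr_pM2r.
Qed.

(* For kappa = 0 the factor is 1 and f is modular, so the factor 1 itself is
   achieved by sorting the singleton values; there only smaller factors are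
   excluded. *)
Theorem theorem4 (R : realType) (kappa eps : R)
    (kappa_ge0 : 0 <= kappa) (kappa_lt1 : kappa < 1) (eps_gt0 : 0 < eps) :
  exists F : oracle_class R,
    [/\ forall n (f : {set 'I_n} -> R),
          F n f -> monotone_submodular_with_curvature kappa f,
        0 < kappa -> no_polynomial_query_algorithm F (curvature_factor kappa eps)
      & forall rho : nat -> R, (forall n, rho n < curvature_factor kappa eps n) ->
          no_polynomial_query_algorithm F rho].
Proof.
exists (fun n => [set f | monotone_submodular_with_curvature kappa f]).
split=> // [kappa_gt0|rho rho_lt].
  by apply: (@curvature_class_hardness _ _ eps) => //; left.
by apply: (@curvature_class_hardness _ _ eps) => // [n|]; [exact: ltW|right].
Qed.
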